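(* Let $\mathbb{A}$ be a non-empty set and $x=x_1x_2x_3\cdots\in\mathbb{A}^{\mathbb N}$ an infinite word. Then $x$ is periodic if and only if there exists an ultrafilter $p\in\beta\mathbb{A}^+$ such that for each $A\in p$ there exists a factorisation $x=u_1u_2u_3\cdots$ with each $u_i\in A$.
   Context: $\mathbb{A}^+$ is the set of non-empty finite words over $\mathbb{A}$; $\beta\mathbb{A}^+$ denotes the set of all ultrafilters on $\mathbb{A}^+$ (the Stone–Čech compactification of the discrete semigroup $\mathbb{A}^+$). An infinite word $x$ is periodic if $x=uuu\cdots$ for some $u\in\mathbb{A}^+$. *)

(* Defs.v *)
From mathcomp Require Import all_boot.
From mathcomp Require Import boolp classical_sets filter.

Set Implicit Arguments.
Unset Strict Implicit.
Unset Printing Implicit Defensive.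

(* The free semigroup A^+. *)
Definition word (A : Type) : Type := {w : seq A | ~~ nilp w}.

(* Infinite words are functions nat -> A, the letter x_(i+1) being [x i]. *)
Definition infinite_word (A : Type) : Type := nat -> A.

Definition prefix_of_length (A : Type) (x : infinite_word A) (n : nat) : seq A :=
  mkseq x n.

Definition finite_product (A : Type) (u : nat -> word A) (n : nat) : seq A :=
  flatten (mkseq (fun i => sval (u i)) n).

(* x = u_0 u_1 u_2 ... : every finite product u_0 ... u_(n-1) is the prefix of x
   of its length.  As the u_i are non-empty these prefixes have unbounded length,
   so that u determines x. *)
Definition factorisation (A : Type) (x : infinite_word A) (u : nat -> word A) :
    Prop :=
  forall n : nat,
    finite_product u n = prefix_of_length x (size (finite_product u n)).

(* Periodic from the first letter on: x = u u u ... *)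
Definition periodic (A : Type) (x : infinite_word A) : Prop :=
  exists u : word A, factorisation x (fun _ : nat => u).

(* Main.v *)
Require Import Defs.
From mathcomp Require Import all_boot.
From mathcomp Require Import boolp classical_sets filter.

(* If x = uuu..., the principal ultrafilter at u works.  Conversely, fix a
   linear order on the letters of x and let x be non-periodic, so that T^n x,
   the word x without its first n letters, differs from x for all n > 0.  In a
   factorisation x = u_0 u_1 ... the first word is a prefix of x, so p contains
   the set of all prefixes of x; up to reversing the order, it also contains the
   set of prefixes u with x <lex T^|u| x, that is, u x <lex x.  A factorisation
   into such words gives
   T^|u_0| x = u_1 u_2 ... = lim u_1 ... u_k x <=lex x, a contradiction. *)

(** This is [x] <lex T^n [x], with [l] the first position of difference. Keeping [lt] a parameter
    lets one argument serve an order and its reverse. *)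
Definition ascends {T : Type} (lt : rel T) (x : nat -> T) (n : nat) : Prop :=
  exists2 l, lt (x l) (x (n + l)) & forall s, s < l -> x (n + s) = x s.

(** No tail of [x] from a boundary [N i] can exceed [x] lexicographically, whereas ascent of [n 0]
    says that the tail from [N 1 = n 0] does. *)
Lemma not_all_ascends (T : Type) (lt : rel T) (x : nat -> T) (n N : nat -> nat) :
  irreflexive lt -> transitive lt ->
  N 0 = 0 -> (forall i, N i.+1 = N i + n i) ->
  (forall i t, t < n i -> x (N i + t) = x t) ->
  ~ forall i, ascends lt x (n i).
Proof.
move=> ltxx lt_trans N0 NS prefixN asc.
(* Strong induction on [t], for all [i] at once: a comparison running past block [i] is moved to the
   boundary [N i.+1]. *)
have tail_le t i : (forall s, s < t -> x (N i + s) = x s) ->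
    ~~ lt (x t) (x (N i + t)).
  elim/ltn_ind: t i => t IH i eqx.
  have [tn|] := ltnP t (n i); first by rewrite prefixN // ltxx.
  have [l ltl eql] := asc i.
  move=> /subnKC; move: (t - n i) => r Er.
  have n_gt0 : 0 < n i.
    by case: (n i) ltl => // ; rewrite add0n ltxx.
  have eqN s : s < r -> x (N i.+1 + s) = x (n i + s).
    by move=> sr; rewrite NS -addnA eqx // -Er ltn_add2l.
  have [lr|rl] := ltnP l r.
    (* The tail from [N i.+1] copies T^(n i) [x] up to [r], so it would already exceed [x] at [l],
       which is before [t]. *)
    have /negP[] : ~~ lt (x l) (x (N i.+1 + l)); last by rewrite eqN.
    apply: IH => [|s sl]; first by rewrite -Er ltn_addl.
    by rewrite eqN ?eql // (ltn_trans sl).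
  have Nr : N i.+1 + r = N i + t by rewrite NS -addnA Er.
  have : ~~ lt (x r) (x (N i.+1 + r)).
    apply: IH => [|s sr]; first by rewrite -Er -[ltnLHS]add0n ltn_add2r.
    by rewrite eqN // eql // (leq_trans sr).
  (* Here [x r] is below [x t] (if [r = l]) or equal to it (if [r < l]), so a rise above [x t] is
     also a rise above [x r]. *)
  apply: contra; rewrite Nr => ltt; move: rl.
  rewrite leq_eqVlt => /predU1P[rl|/eql <-]; last by rewrite Er.
  by apply: lt_trans ltt; rewrite -Er rl.
have [l ltl eql] := asc 0.
by have := tail_le l 1; rewrite NS N0 ltl => /(_ eql).
Qed.

(** Ranking a letter by its first occurrence in [x] orders the letters of [x] with no order given on
    [A]. *)
Lemma letter_rank (A : Type) (x : nat -> A) :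
  exists r : nat -> nat, forall i j, r i = r j <-> x i = x j.
Proof.
have ex_first i : exists j, `[< x j = x i >] by exists i; apply/asboolP.
exists (fun i => ex_minn (ex_first i)) => i j; split.
  by case: ex_minnP => k /asboolP <- _; case: ex_minnP => m /asboolP <- _ ->.
move=> eqx; apply/eqP; rewrite eqn_leq.
case: ex_minnP => k /asboolP xk mink; case: ex_minnP => m /asboolP xm minm.
by rewrite mink ?minm //; apply/asboolP; rewrite ?xk ?xm.
Qed.

Lemma nth_mkseq_prefix (T : Type) (x : nat -> T) (s1 s2 : seq T) (m t : nat)
    (a : T) :
  s1 ++ s2 = mkseq x m -> t < size s2 -> nth a s2 t = x (size s1 + t).
Proof.
move=> Es ts; have <- : nth a (s1 ++ s2) (size s1 + t) = nth a s2 t.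
  by rewrite nth_cat ltnNge leq_addr addKn.
rewrite Es nth_mkseq //; have := congr1 size Es.
by rewrite size_cat size_mkseq => <-; rewrite ltn_add2l.
Qed.

Lemma finite_productS (A : Type) (u : nat -> word A) (n : nat) :
  finite_product u n.+1 = finite_product u n ++ sval (u n).
Proof. by rewrite /finite_product mkseqS flatten_rcons. Qed.

Lemma mkseqD (T : Type) (x : nat -> T) (m n : nat) :
  mkseq x (m + n) = mkseq x m ++ mkseq (fun t => x (m + t)) n.
Proof.
by rewrite /mkseq iotaD map_cat add0n -[in iota m n](addn0 m) iotaDl -map_comp.
Qed.

Lemma shift_periodic (A : Type) (x : infinite_word A) (n : nat) :
  0 < n -> (forall t, x (n + t) = x t) -> periodic x.
Proof.
move=> n_gt0 xn.
have u_neq0 : ~~ nilp (mkseq x n) by rewrite /nilp size_mkseq -lt0n.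
have xkn k t : x (k * n + t) = x t.
  by elim: k => // k IH; rewrite mulSn -addnA xn.
pose u : word A := exist (fun w => ~~ nilp w) _ u_neq0.
exists u => k.
suff -> : finite_product (fun=> u) k = mkseq x (k * n).
  by rewrite /prefix_of_length size_mkseq.
elim: k => [|k IH]; first by [].
rewrite finite_productS IH mulSnr mkseqD; congr (_ ++ _).
by apply: eq_mkseq => t; rewrite xkn.
Qed.

Definition prefix_words {A : Type} (x : infinite_word A) : set (word A) :=
  [set w | sval w = mkseq x (size (sval w))]%classic.

(** The lengths of the partial products serve as the boundaries [N i]; each block repeats the
    beginning of [x] because its factor is a prefix. *)
Lemma factorisation_not_all_ascends (A T : Type) (lt : rel T)
    (x : infinite_word A) (r : nat -> T) (u : nat -> word A) :
  irreflexive lt -> transitive lt -> (forall i j, x i = x j -> r i = r j) ->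
  factorisation x u -> (forall i, prefix_words x (u i)) ->
  ~ forall i, ascends lt r (size (sval (u i))).
Proof.
move=> ltxx lt_trans r_x xu pu.
apply: (@not_all_ascends _ lt r _ (fun i => size (finite_product u i))) => //.
  by move=> i; rewrite finite_productS size_cat.
move=> i t ti; apply: r_x.
have := xu i.+1; rewrite finite_productS =>
  /(@nth_mkseq_prefix _ _ _ _ _ t (x 0)).
by move=> /(_ ti) <-; rewrite pu nth_mkseq.
Qed.

Theorem theorem2 (A : Type) (A_nonempty : inhabited A) (x : infinite_word A) :
  periodic x <->
  exists p : set_system (word A),
    UltraFilter p /\
    forall B : set (word A), p B ->
      exists u : nat -> word A, factorisation x u /\ forall i : nat, B (u i).
Proof.
split=> [[u xu]|[p [p_ultra pP]]].
  exists (principal_filter u); split; first exact: principal_filter_ultra.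
  by move=> B /principal_filterP Bu; exists (fun=> u).
apply: contrapT => x_aper.
have pF : Filter p by case: p_ultra => -[].
have p_prefix : p (prefix_words x).
  have [//|/pP[u [xu /(_ 0)]]] := in_ultra_setVsetC (prefix_words x) p_ultra.
  have := xu 1; rewrite finite_productS /finite_product /=.
  by move=> xu0 /(_ xu0).
have [r rx] := letter_rank _ x.
have not_ascents (lt : rel nat) : irreflexive lt -> transitive lt ->
    ~ p [set w : word A | ascends lt r (size (sval w))]%classic.
  move=> ltxx lt_trans /(filterI p_prefix)/pP[u [xu pu]].
  apply: (@factorisation_not_all_ascends _ _ lt x r u) => //.
  - by move=> i j /rx.
  - by move=> i; case: (pu i).
  - by move=> i; case: (pu i).
have [|p_desc] := in_ultra_setVsetC
    [set w : word A | ascends ltn r (size (sval w))]%classic p_ultra.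
  by apply: not_ascents; [exact: ltnn|exact: ltn_trans].
apply: (not_ascents (fun i j => j < i)) => [i|j i k ij jk|].
- exact: ltnn.
- exact: ltn_trans jk ij.
apply: filterS p_desc => -[w w_neq0] /= not_asc.
have w_gt0 : 0 < size w by rewrite lt0n.
(* A shift by [size w] that changed no rank would make [x] periodic. At the first change the ranks
   are comparable, so a word that does not ascend for [<] ascends for the reverse order. *)
have ex_diff : exists l, r (size w + l) != r l.
  apply: contrapT => no_diff; apply/x_aper/(shift_periodic _ _ _ w_gt0) => t.
  by apply/rx/eqP; apply: contrapT => /negP neq; apply: no_diff; exists t.
case: (ex_minnP ex_diff) => l neql minl.
have eql s : s < l -> r (size w + s) = r s.
  by move=> sl; apply/eqP; apply: contraLR sl => /minl; rewrite -leqNgt.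
exists l => //; case: ltngtP neql => // lt_l _.
by case: not_asc; exists l.
Qed.
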